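(* Let $E$ be a proper linear subspace of $M_2(\mathbb{C})$ with $E_{\mathrm{diag}}\subseteq E$. Then $\mathbb{F}_{\mu_E}=\mathbb{F}$ if and only if \[ E=\left\{\begin{pmatrix} z_1 & w\\ e^{i\theta}w & z_2\end{pmatrix} : z_1,z_2,w\in\mathbb{C}\right\}\quad\text{for some } \theta\in\mathbb{R}. \]
   Context: $M_2(\mathbb{C})$ is the space of $2\times 2$ complex matrices, $\|A\|$ is the operator norm of $A$, and $E_{\mathrm{diag}}$ is the subspace of all diagonal matrices in $M_2(\mathbb{C})$; linear subspaces are complex linear subspaces. The domain $\mathbb{F}$ is \[ \mathbb{F}=\{(a_{11},a_{22},\det(A),a_{12}+a_{21})\in\mathbb{C}^4 : A=(a_{ij})_{i,j=1}^2\in M_2(\mathbb{C}),\ \|A\|<1\}. \] For a linear subspace $E\subseteq M_2(\mathbb{C})$, the structured singular value of $A\in M_2(\mathbb{C})$ relative to $E$ is \[ \mu_E(A)=\left(\inf\{\|X\| : X\in E,\ \det(I-AX)=0\}\right)^{-1}, \] with $\mu_E(A)=0$ if there is no $X\in E$ with $\det(I-AX)=0$; and \[ \mathbb{F}_{\mu_E}=\{(a_{11},a_{22},\det(A),a_{12}+a_{21}) : A=(a_{ij})_{i,j=1}^2\in M_2(\mathbb{C}),\ \mu_E(A)<1\}. \] *)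

(* Defs.v *)
From HB Require Import structures.
From mathcomp Require Import all_boot all_order all_algebra.
From mathcomp Require Import complex.
From mathcomp Require Import boolp classical_sets reals exp trigo.

Set Implicit Arguments.
Unset Strict Implicit.
Unset Printing Implicit Defensive.

Import Order.TTheory GRing.Theory Num.Theory.

Local Open Scope classical_set_scope.
Local Open Scope ring_scope.

Section StructuredSingularValue.
Context {R : realType}.
Local Notation C := R[i].

Definition cis (theta : R) : C := Complex (cos theta) (sin theta).

(* The norm that MathComp-Analysis puts on matrices is the entrywise maximum,
   hence the explicit Euclidean and operator norms. *)
Definition l2norm (n : nat) (v : 'cV[C]_n) : R :=
  Num.sqrt (\sum_(i < n) Normc.normc (v i 0) ^+ 2).

Definition opnorm (m n : nat) (A : 'M[C]_(m, n)) : R :=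
  sup [set l2norm (A *m v) | v in [set v : 'cV[C]_n | l2norm v <= 1]].

Definition mx2 (a b c d : C) : 'M[C]_2 :=
  \matrix_(i < 2, j < 2)
    if i == 0 then (if j == 0 then a else b) else (if j == 0 then c else d).

Definition Ediag : set 'M[C]_2 := [set A | is_diag_mx A].

Definition Etheta (theta : R) : set 'M[C]_2 :=
  [set A | exists z1 z2 w : C, A = mx2 z1 w (cis theta * w) z2].

Definition mu (E : {vspace 'M[C]_2}) (A : 'M[C]_2) : R :=
  let S := [set X : 'M[C]_2 | X \in E /\ \det (1%:M - A *m X) = 0] in
  if `[< S !=set0 >] then (inf [set opnorm X | X in S])^-1 else 0.

Definition coords (A : 'M[C]_2) : C * C * C * C :=
  (A 0 0, A 1 1, \det A, A 0 1 + A 1 0).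

Definition domF : set (C * C * C * C) :=
  [set coords A | A in [set A : 'M[C]_2 | opnorm A < 1]].

Definition domFmu (E : {vspace 'M[C]_2}) : set (C * C * C * C) :=
  [set coords A | A in [set A : 'M[C]_2 | mu E A < 1]].

End StructuredSingularValue.

(* Main.v *)
Require Import Defs.
From mathcomp Require Import all_boot all_order all_algebra.
From mathcomp Require Import complex.
From mathcomp Require Import boolp classical_sets reals exp trigo.
From mathcomp Require Import ring lra.

(** mu_E <= ||.|| always holds, so the domains agree as soon as every A with
    ||A|| >= 1 has mu_E(A) >= 1. For E = E_theta take v nearly maximizing
    ||Av||: E_theta contains a unitary X sending Av/||Av|| to v/||v||, and the
    multiple Y of X with Y(Av) = v makes det(I - AY) vanish.

    Conversely the matrix units e12 and e21 have the coordinates (0,0,0,1),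
    which are outside F, so mu_E(e12) >= 1 and mu_E(e21) >= 1. The first forces
    E to contain a matrix with 21-entry 1, whence, E being proper and containing
    the diagonal, E is cut out by x12 = b x21; the bounds then give |b| <= 1 and
    |b| >= 1. *)

Set Implicit Arguments.
Unset Strict Implicit.
Unset Printing Implicit Defensive.

Import Order.TTheory GRing.Theory Num.Theory.

Local Open Scope classical_set_scope.
Local Open Scope ring_scope.

(** * Complex moduli and the Euclidean norm *)

Lemma normc_ge0 (R : rcfType) (z : R[i]) : 0 <= Normc.normc z.
Proof. by case: z => a b; exact: sqrtr_ge0. Qed.

Lemma normC_normc (R : rcfType) (z : R[i]) : `|z| = (Normc.normc z)%:C%C.
Proof. by case: z. Qed.

Lemma sqr_normcE (R : rcfType) (z : R[i]) :
  (Normc.normc z ^+ 2)%:C%C = z * (z^*)%C.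
Proof. by rewrite rmorphXn /= -normC_normc sqr_normc. Qed.

Lemma l2norm_ge0 (R : realType) n (v : 'cV[R[i]]_n) : 0 <= l2norm v.
Proof. exact: sqrtr_ge0. Qed.

Lemma sqr_l2norm (R : realType) n (v : 'cV[R[i]]_n) :
  l2norm v ^+ 2 = \sum_(i < n) Normc.normc (v i 0) ^+ 2.
Proof. by rewrite sqr_sqrtr // sumr_ge0 // => i _; exact: sqr_ge0. Qed.

Lemma sqr_l2normE (R : realType) n (v : 'cV[R[i]]_n) :
  (l2norm v ^+ 2)%:C%C = \sum_(i < n) v i 0 * (v i 0)^*%C.
Proof.
by rewrite sqr_l2norm rmorph_sum; apply: eq_bigr => i _; rewrite -sqr_normcE.
Qed.

Lemma l2normZ (R : realType) n (c : R[i]) (v : 'cV[R[i]]_n) :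
  l2norm (c *: v) = Normc.normc c * l2norm v.
Proof.
apply/eqP; rewrite -(eqrXn2 (n := 2)) ?mulr_ge0 ?l2norm_ge0 ?normc_ge0 //.
rewrite exprMn !sqr_l2norm mulr_sumr; apply/eqP/eq_bigr => i _.
by rewrite mxE Normc.normcM exprMn.
Qed.

Lemma normc_le_l2norm (R : realType) n (v : 'cV[R[i]]_n) i :
  Normc.normc (v i 0) <= l2norm v.
Proof.
rewrite -(ler_pXn2r (ltn0Sn 1)) ?nnegrE ?l2norm_ge0 ?normc_ge0 //.
rewrite sqr_l2norm (bigD1 i) //= lerDl sumr_ge0 // => j _; exact: sqr_ge0.
Qed.

Lemma l2norm0 (R : realType) n : l2norm (0 : 'cV[R[i]]_n) = 0.
Proof. by rewrite -(scale0r 0) l2normZ Normc.normc0 mul0r. Qed.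

Lemma l2norm_gt0 (R : realType) n (v : 'cV[R[i]]_n) : v != 0 -> 0 < l2norm v.
Proof.
move=> v0; rewrite lt_neqAle l2norm_ge0 andbT eq_sym.
apply: contra v0 => /eqP v0; apply/eqP/matrixP => i j; rewrite mxE (ord1 j).
apply: Normc.eq0_normc; apply/le_anti; rewrite normc_ge0 andbT -v0.
exact: normc_le_l2norm.
Qed.

Lemma l2norm_delta (R : realType) n (i : 'I_n) :
  l2norm (delta_mx i 0 : 'cV[R[i]]_n) = 1.
Proof.
apply/eqP; rewrite -(eqrXn2 (n := 2)) ?l2norm_ge0 // sqr_l2norm expr1n.
rewrite (bigD1 i) //= big1 => [|j ji]; rewrite mxE ?(negPf ji) ?eqxx.
  by rewrite Normc.normc1 expr1n addr0.
by rewrite Normc.normc0 expr0n.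
Qed.

Lemma normc_sum (R : rcfType) (I : finType) (F : I -> R[i]) :
  Normc.normc (\sum_i F i) <= \sum_i Normc.normc (F i).
Proof.
by rewrite -lecR rmorph_sum -normC_normc ler_norm_sum.
Qed.

(** * The operator norm *)

(** Entries of a vector in the unit ball have modulus at most 1, so each coordinate of [A *m v] is
    bounded by the sum of the moduli in its row. Boundedness is what makes the [sup] in [opnorm]
    meaningful. *)
Lemma has_ubound_opnorm (R : realType) m n (A : 'M[R[i]]_(m, n)) :
  has_ubound [set l2norm (A *m v) | v in [set v : 'cV[R[i]]_n | l2norm v <= 1]].
Proof.
exists (Num.sqrt (\sum_i (\sum_j Normc.normc (A i j)) ^+ 2)) => _ [v /= v1 <-].
apply: ler_wsqrtr; apply: ler_sum => i _.
rewrite ler_pXn2r ?nnegrE ?normc_ge0 ?sumr_ge0 // => [|j _]; last exact: normc_ge0.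
rewrite mxE; apply: le_trans (normc_sum _) _; apply: ler_sum => j _.
rewrite Normc.normcM ler_piMr ?normc_ge0 //.
exact: le_trans (normc_le_l2norm _ _) v1.
Qed.

Lemma opnorm_ge0 (R : realType) m n (A : 'M[R[i]]_(m, n)) : 0 <= opnorm A.
Proof.
apply: (ub_le_sup (has_ubound_opnorm A)).
by exists 0; rewrite /= ?mulmx0 l2norm0.
Qed.

Lemma l2norm_mulmx (R : realType) m n (A : 'M[R[i]]_(m, n)) v :
  l2norm (A *m v) <= opnorm A * l2norm v.
Proof.
have [->|v0] := eqVneq v 0; first by rewrite mulmx0 !l2norm0 mulr0.
have vp := l2norm_gt0 v0.
have nV : Normc.normc ((l2norm v)^-1)%:C%C = (l2norm v)^-1.
  by rewrite /= expr0n addr0 sqrtr_sqr ger0_norm // invr_ge0 ltW.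
rewrite -ler_pdivrMr //; apply: (ub_le_sup (has_ubound_opnorm A)).
exists (((l2norm v)^-1)%:C%C *: v) => /=.
  by rewrite l2normZ nV mulVf ?gt_eqF.
by rewrite -scalemxAr l2normZ nV mulrC.
Qed.

Lemma opnorm_le (R : realType) m n (A : 'M[R[i]]_(m, n)) (K : R) : 0 <= K ->
  (forall v, l2norm (A *m v) <= K * l2norm v) -> opnorm A <= K.
Proof.
move=> K0 AK; apply: ge_sup => [|_ [v /= v1 <-]].
  by exists (l2norm (A *m 0)), 0 => //=; rewrite l2norm0.
by apply: le_trans (AK v) _; rewrite ler_piMr.
Qed.

Lemma normc_le_opnorm (R : realType) m n (A : 'M[R[i]]_(m, n)) i j :
  Normc.normc (A i j) <= opnorm A.
Proof.
have := l2norm_mulmx A (delta_mx j 0); rewrite l2norm_delta mulr1.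
apply: le_trans; have := normc_le_l2norm (A *m delta_mx j 0) i.
by rewrite -colE mxE.
Qed.

(** A singular [1 - A *m X] has a nonzero kernel vector, that is, a fixed vector of [A *m X];
    compare norms. The transposes turn the row vector supplied by [det0P] into a column. *)
Lemma det_sub_mulmx_opnorm (R : realType) n (A X : 'M[R[i]]_n) :
  \det (1%:M - A *m X) = 0 -> 1 <= opnorm A * opnorm X.
Proof.
rewrite -det_tr => /eqP/det0P [w w0 /(congr1 trmx)].
rewrite trmx_mul trmxK trmx0 mulmxBl mul1mx => /subr0_eq ew.
have wp : 0 < l2norm w^T.
  by apply: l2norm_gt0; apply: contra w0 => /eqP/(canRL trmxK) ->; rewrite trmx0.
rewrite -(ler_pM2r wp) mul1r {1}ew -mulmxA -mulrA.
apply: le_trans (l2norm_mulmx _ _) _.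
by rewrite ler_wpM2l ?opnorm_ge0 ?l2norm_mulmx.
Qed.

(** * Criteria for comparing the structured singular value with 1 *)

(** A uniform gap [c > 1] is required because norms that merely exceed 1 could still have infimum
    1. *)
Lemma mu_lt1 (R : realType) (E : {vspace 'M[R[i]]_2}) A (c : R) : 1 < c ->
  (forall X, X \in E -> \det (1%:M - A *m X) = 0 -> c <= opnorm X) ->
  mu E A < 1.
Proof.
move=> c1 Ec; rewrite /mu; case: asboolP => [[X0 SX0]|_]; last exact: ltr01.
have cI : c <= inf [set opnorm X | X in
    [set X | X \in E /\ \det (1%:M - A *m X) = 0]].
  apply: lb_le_inf; first by exists (opnorm X0), X0.
  by move=> _ [X [EX dX] <-]; exact: Ec.
by rewrite invf_lt1 ?(lt_le_trans c1) // (lt_trans _ (lt_le_trans c1 cI)).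
Qed.

Lemma mu_lt1_opnorm (R : realType) (E : {vspace 'M[R[i]]_2}) A :
  opnorm A < 1 -> mu E A < 1.
Proof.
move=> A1; have A0 := opnorm_ge0 A.
(* This constant exceeds 1, is at most the inverse of the norm of [A], and stays defined for
   [A = 0]. *)
apply: (@mu_lt1 _ _ _ (2 / (1 + opnorm A))).
  by rewrite ltr_pdivlMr; lra.
move=> X _ /det_sub_mulmx_opnorm dX; have X0 := opnorm_ge0 X.
by rewrite ler_pdivrMr; nra.
Qed.

(** The admissible norms come arbitrarily close to 1 or below, so their infimum is at most 1.
    Approximate witnesses suffice, so no supremum or infimum has to be attained. *)
Lemma mu_ge1 (R : realType) (E : {vspace 'M[R[i]]_2}) A :
  (forall s, 0 < s < 1 -> exists X, [/\ X \in E,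
    \det (1%:M - A *m X) = 0 & opnorm X <= s^-1]) ->
  1 <= mu E A.
Proof.
move=> AE; rewrite /mu; case: asboolP => [_|]; last first.
  have [|X [EX dX _]] := AE 2^-1; first by lra.
  by case; exists X.
set S := [set _ | _ in _].
(* The infimum must be shown positive: the inverse of 0 is 0 by convention, which would make [mu]
   vanish. *)
have lbS : lbound S (opnorm A + 1)^-1.
  move=> _ [X [_ /det_sub_mulmx_opnorm dX] <-].
  have A0 := opnorm_ge0 A; have X0 := opnorm_ge0 X.
  by rewrite -div1r ler_pdivrMr; nra.
have S0 : S !=set0.
  have [|X [EX dX _]] := AE 2^-1; first by lra.
  by exists (opnorm X), X.
have I0 : 0 < inf S.
  apply: lt_le_trans (lb_le_inf S0 lbS); rewrite invr_gt0.
  by rewrite ltr_wpDl ?opnorm_ge0.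
rewrite invf_ge1 // leNgt; apply/negP => I1.
(* The inverse of [s] is the midpoint of 1 and [inf S], so the witness for [s] would have norm below
   the infimum. *)
pose s := 2 / (1 + inf S).
have [|X [EX dX Xs]] := AE s.
  by rewrite divr_gt0 ?ltr_pdivrMr /=; lra.
have : inf S <= opnorm X by apply: ge_inf; [exists (opnorm A + 1)^-1 | exists X].
by move=> /le_trans/(_ Xs); rewrite invf_div; lra.
Qed.

(** * Unitary matrices in [Etheta] *)

Lemma mx2_mul (R : realType) (a b c d : R[i]) (x : 'cV[R[i]]_2) :
  mx2 a b c d *m x =
  \col_i if i == 0 then a * x 0 0 + b * x 1 0 else c * x 0 0 + d * x 1 0.
Proof.
apply/colP => i; rewrite !mxE !big_ord_recl big_ord0 addr0 !mxE /=.
rewrite (_ : lift ord0 ord0 = 1); last exact: val_inj.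
by case: ifP.
Qed.

Lemma sqr_l2norm2 (R : realType) (v : 'cV[R[i]]_2) :
  (l2norm v ^+ 2)%:C%C = v 0 0 * (v 0 0)^*%C + v 1 0 * (v 1 0)^*%C.
Proof.
rewrite sqr_l2normE !big_ord_recl big_ord0 addr0.
by rewrite (_ : lift ord0 ord0 = 1) //; exact: val_inj.
Qed.

Lemma mulcJ_cis (R : realType) (theta : R) :
  cis theta * (cis theta)^*%C = 1.
Proof.
apply/eqP; rewrite eq_complex /= mulrN opprK -!expr2 cos2Dsin2 eqxx /=.
by rewrite mulrN mulrC addNr.
Qed.

(* With v' = (-conj v2, conj v1) and u' = (-conj u2, conj u1), the matrix
   X = v u^* + d v' u'^* is unitary and maps u to v for every unimodular d;
   requiring X21 = cis theta * X12 reads q = - d * cis theta * conj q for the q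
   below, which fixes d when q != 0. *)
Lemma Etheta_isometry (R : realType) (theta : R) (u v : 'cV[R[i]]_2) :
  l2norm u = 1 -> l2norm v = 1 ->
  exists X, [/\ Etheta theta X, X *m u = v & forall x, l2norm (X *m x) = l2norm x].
Proof.
move=> nu nv; have := mulcJ_cis theta; move Eeta : (cis theta) => eta eta1.
have := sqr_l2norm2 u; have := sqr_l2norm2 v; rewrite nu nv expr1n.
set u1 := u 0 0; set u2 := u 1 0; set v1 := v 0 0; set v2 := v 1 0.
move=> v1E u1E.
pose q := v2 * u1^*%C - eta * v1 * u2^*%C.
have [d [d1 dq]] : exists d : R[i], d * d^*%C = 1 /\ q = - d * eta * q^*%C.
  have [q0|q0] := eqVneq q 0.
    by exists 1; rewrite q0 conjc0 conjc1 !mulr1 mulr0.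
  have qc0 : q^*%C != 0 by rewrite conjc_eq0.
  (* Solving the equation for [d]; the result is unimodular since [q] and its conjugate have equal
     modulus. *)
  exists (- eta^*%C * q / q^*%C); split.
    rewrite !rmorphM rmorphN /= conjc_inv !conjcK -eta1.
    by field; rewrite q0 qc0.
  rewrite -[LHS]mul1r -eta1; by field; exact: qc0.
exists (mx2 (v1 * u1^*%C + d * v2^*%C * u2) (v1 * u2^*%C - d * v2^*%C * u1)
            (v2 * u1^*%C - d * v1^*%C * u2) (v2 * u2^*%C + d * v1^*%C * u1)).
split.
- exists (v1 * u1^*%C + d * v2^*%C * u2), (v2 * u2^*%C + d * v1^*%C * u1).
  exists (v1 * u2^*%C - d * v2^*%C * u1); rewrite Eeta; congr mx2.
  move: dq; rewrite /q !(rmorphB, rmorphM) /= !conjcK => dq.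
  apply/eqP; rewrite -subr_eq0; apply/eqP.
  (* Inserting [eta * eta^* = 1] turns the subtracted bracket into [- d * eta * q^*], which is [q]
     by the choice of [d]. *)
  transitivity ((v2 * u1^*%C - eta * v1 * u2^*%C)
    - (d * (eta * eta^*%C) * v1^*%C * u2 - d * eta * v2^*%C * u1)).
    by rewrite eta1; ring.
  by rewrite dq; ring.
- apply/colP => i; rewrite mx2_mul mxE -/u1 -/u2.
  case: ifP => [/eqP ->|i0].
    transitivity (v1 * (u1 * u1^*%C + u2 * u2^*%C)); first by ring.
    by rewrite -u1E mulr1.
  have -> : i = 1 by apply: val_inj; case: i i0 => [[|[|]]].
  transitivity (v2 * (u1 * u1^*%C + u2 * u2^*%C)); first by ring.
  by rewrite -u1E mulr1.
move=> x; apply/eqP; rewrite -(eqrXn2 (n := 2)) ?l2norm_ge0 //; apply/eqP.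
apply: complexI; rewrite !sqr_l2norm2 mx2_mul !mxE /=.
set x1 := x 0 0; set x2 := x 1 0.
rewrite !(rmorphB, rmorphD, rmorphM) /= !conjcK.
(* These are the coordinates of [x] in the orthonormal basis u, u', so X x = t v + d s v'. The
   second [transitivity] below is Lagrange's identity. *)
pose t := u1^*%C * x1 + u2^*%C * x2; pose s := u1 * x2 - u2 * x1.
transitivity ((v1 * v1^*%C + v2 * v2^*%C) * (t * t^*%C + d * d^*%C * (s * s^*%C))).
  rewrite /t /s !(rmorphB, rmorphD, rmorphM) /= !conjcK; ring.
rewrite -v1E d1 !mul1r.
transitivity ((u1 * u1^*%C + u2 * u2^*%C) * (x1 * x1^*%C + x2 * x2^*%C)).
  rewrite /t /s !(rmorphB, rmorphD, rmorphM) /= !conjcK; ring.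
by rewrite -u1E mul1r.
Qed.

Lemma normc_real (R : rcfType) (r : R) : 0 <= r -> Normc.normc r%:C%C = r.
Proof. by move=> r0; rewrite /= expr0n addr0 sqrtr_sqr ger0_norm. Qed.

Lemma Etheta_mu_ge1 (R : realType) (theta : R) (E : {vspace 'M[R[i]]_2}) A :
  [set` E] = Etheta theta -> 1 <= opnorm A -> 1 <= mu E A.
Proof.
move=> Eth A1; apply: mu_ge1 => s /andP[s0 s1].
have [_ [v /= v1 <-] sAv] : exists2 y, [set l2norm (A *m v) | v in
    [set v : 'cV[R[i]]_2 | l2norm v <= 1]] y & s < y.
  apply: sup_gt; last exact: lt_le_trans A1.
  by exists (l2norm (A *m 0)), 0 => //=; rewrite l2norm0.
set t := l2norm (A *m v) in sAv.
have t0 : 0 < t by exact: lt_trans sAv.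
have v0 : v != 0.
  by apply: contraTneq t0 => v0; rewrite /t v0 mulmx0 l2norm0 ltxx.
have vp := l2norm_gt0 v0.
have realV (r : R) : 0 < r -> r%:C%C * (r^-1)%:C%C = 1.
  by move=> r0; rewrite -rmorphM divff ?gt_eqF.
have unitV n (w : 'cV[R[i]]_n) :
    0 < l2norm w -> l2norm ((l2norm w)^-1%:C%C *: w) = 1.
  by move=> w0; rewrite l2normZ normc_real ?invr_ge0 ?ltW // mulVf ?gt_eqF.
have [X [EX Xu Xiso]] := Etheta_isometry theta (unitV _ _ t0) (unitV _ _ vp).
(* The scaling makes this matrix send [A *m v] to [v], so [A *m v] is the kernel vector sought. Its
   norm is at most [l2norm v / t], which is at most [s^-1] because [l2norm v <= 1] and [s < t]. *)
exists ((l2norm v / t)%:C%C *: X); split.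
- by apply: memvZ; have : [set` E] X by rewrite Eth.
- have Av0 : A *m v != 0.
    by apply: contraTneq t0 => Av0; rewrite /t Av0 l2norm0 ltxx.
  rewrite -det_tr; apply/eqP/det0P; exists (A *m v)^T.
    by apply: contra Av0 => /eqP/(canRL trmxK) ->; rewrite trmx0.
  rewrite -trmx_mul mulmxBl mul1mx -[_ *m (A *m v)]mulmxA -scalemxAl.
  have -> : X *m (A *m v) = t%:C%C *: ((l2norm v)^-1%:C%C *: v).
    by rewrite -Xu -scalemxAr scalerA realV // scale1r.
  rewrite !scalerA -!rmorphM (_ : _ * _ = 1) ?scale1r ?subrr ?trmx0 //.
  by field; rewrite !gt_eqF.
apply: opnorm_le => [|x]; first by rewrite invr_ge0 ltW.
rewrite -scalemxAl l2normZ normc_real ?(divr_ge0 (ltW vp) (ltW t0)) // Xiso.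
rewrite ler_wpM2r ?l2norm_ge0 // ler_pdivrMr // mulrC.
by rewrite (le_trans v1) // ler_pdivlMr // mul1r ltW.
Qed.

(** * Unimodular numbers and the point (0, 0, 0, 1) *)

(** The angle [acos a] has the right cosine and a nonnegative sine, so the sign of the imaginary
    part decides between it and its opposite. *)
Lemma cis_surj (R : realType) (z : R[i]) :
  Normc.normc z = 1 -> exists theta, cis theta = z.
Proof.
case: z => a b nz; have ab : a ^+ 2 + b ^+ 2 = 1.
  by rewrite -(sqr_sqrtr (addr_ge0 (sqr_ge0 a) (sqr_ge0 b))) [Num.sqrt _]nz expr1n.
have a1 : -1 <= a <= 1 by apply/andP; split; nra.
have ca : cos (acos a) = a by rewrite acosK // in_itv.
have sa : sin (acos a) = `|b|.
  by rewrite sin_acos // -ab addrC addKr sqrtr_sqr.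
have [b0|b0] := leP 0 b.
  by exists (acos a); rewrite /cis ca sa ger0_norm.
by exists (- acos a); rewrite /cis cosN sinN ca sa ltr0_norm // opprK.
Qed.

Lemma det2 (K : comNzRingType) (A : 'M[K]_2) :
  \det A = A 0 0 * A 1 1 - A 0 1 * A 1 0.
Proof.
rewrite (expand_det_row _ 0) !big_ord_recl big_ord0 /cofactor !det_mx11 !mxE.
rewrite (_ : lift 0 0 = 1); last exact: val_inj.
rewrite (_ : lift 1 0 = 0); last exact: val_inj.
by rewrite /= /bump /=; ring.
Qed.

Lemma mx2P (R : realType) (A B : 'M[R[i]]_2) :
  A 0 0 = B 0 0 -> A 0 1 = B 0 1 -> A 1 0 = B 1 0 -> A 1 1 = B 1 1 -> A = B.
Proof.
have ord2 (i : 'I_2) : i = 0 \/ i = 1.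
  by case: i => [[|[|]]] // p; [left|right]; exact: val_inj.
by move=> *; apply/matrixP => i j; case: (ord2 i) => ->; case: (ord2 j) => ->.
Qed.

(** The off-diagonal entries have product 0 and sum 1, so one of them is 1, and every entry bounds
    the norm from below. *)
Lemma opnorm_coords0001 (R : realType) (A : 'M[R[i]]_2) :
  coords A = (0, 0, 0, 1) -> 1 <= opnorm A.
Proof.
rewrite /coords det2 => -[-> _]; rewrite mul0r sub0r => /eqP.
rewrite oppr_eq0 mulf_eq0 => /orP[] /eqP ->; rewrite ?add0r ?addr0 => A1.
  by have := normc_le_opnorm A 1 0; rewrite A1 Normc.normc1.
by have := normc_le_opnorm A 0 1; rewrite A1 Normc.normc1.
Qed.

Lemma mu_ge1_coords0001 (R : realType) (E : {vspace 'M[R[i]]_2}) A :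
  domFmu E = domF -> coords A = (0, 0, 0, 1) -> 1 <= mu E A.
Proof.
move=> FE cA; rewrite leNgt; apply/negP => muA.
have : domFmu E (coords A) by exists A.
rewrite FE => -[B /= B1 cB]; have := B1.
by rewrite ltNge opnorm_coords0001 // cB.
Qed.

(** * Comparison of the two domains *)

Theorem theorem4p3 (R : realType) (E : {vspace 'M[R[i]]_2})
    (E_proper : E != fullv) (Ediag_sub : Ediag `<=` [set` E]) :
  domFmu E = domF <-> exists theta : R, [set` E] = Etheta theta.
Proof.
split; last first.
  move=> [theta Eth]; apply/seteqP; split=> _ [A /= A1 <-]; exists A => //=.
    by rewrite ltNge; apply: contraTN A1 => A1; rewrite -leNgt (Etheta_mu_ge1 Eth).
  exact: mu_lt1_opnorm.
move=> FE.
have diagE a d : mx2 a 0 0 d \in E.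
  apply: (Ediag_sub (mx2 a 0 0 d)); apply/is_diag_mxP => i j; rewrite mxE.
  by case: i j => [[|[|]]] // ? [[|[|]]].
have mu12 : 1 <= mu E (mx2 0 1 0 0).
  by apply: mu_ge1_coords0001 => //; rewrite /coords det2 !mxE /= !mulr0 subr0 addr0.
have mu21 : 1 <= mu E (mx2 0 0 1 0).
  by apply: mu_ge1_coords0001 => //; rewrite /coords det2 !mxE /= !mul0r subr0 add0r.
have ord2_1 : lift ord0 ord0 = 1 :> 'I_2 by exact: val_inj.
have det12 X : \det (1%:M - mx2 0 1 0 0 *m X) = 0 -> X 1 0 = 1.
  have -> : \det (1%:M - mx2 0 1 0 0 *m X) = 1 - X 1 0.
    by rewrite det2 !mxE !big_ord_recl !big_ord0 !mxE /= ord2_1; ring.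
  by move/subr0_eq.
have det21 X : \det (1%:M - mx2 0 0 1 0 *m X) = 0 -> X 0 1 = 1.
  have -> : \det (1%:M - mx2 0 0 1 0 *m X) = 1 - X 0 1.
    by rewrite det2 !mxE !big_ord_recl !big_ord0 !mxE /= ord2_1; ring.
  by move/subr0_eq.
(* Without such a [Y] no element of [E] is admissible for e12 and [mu] is 0; the bound 2 is then
   arbitrary. *)
have [Y EY Y10] : exists2 Y, Y \in E & Y 1 0 = 1.
  apply: contrapT => noY; move: mu12; rewrite leNgt => /negP; apply.
  apply: (@mu_lt1 _ _ _ 2) => [|X EX /det12 X10]; first by rewrite ltr1n.
  by case: noY; exists X.
set b := Y 0 1 in EY.
have Eb : mx2 0 b 1 0 \in E.
  rewrite (_ : mx2 _ _ _ _ = Y - mx2 (Y 0 0) 0 0 (Y 1 1)) ?rpredB //.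
  by apply: mx2P; rewrite !mxE /= ?subrr ?subr0.
have E01 X : X \in E -> X 0 1 = b * X 1 0.
  move=> EX; apply: contrapT => Xb.
  have k0 : X 0 1 - b * X 1 0 != 0 by rewrite subr_eq0; apply/eqP.
  (* A violation of the relation would put e12 in [E]; with the diagonal and [mx2 0 b 1 0] it spans
     all matrices, against properness. *)
  have E12 : mx2 0 1 0 0 \in E.
    rewrite (_ : mx2 _ _ _ _ = (X 0 1 - b * X 1 0)^-1 *:
      (X - mx2 (X 0 0) 0 0 (X 1 1) - X 1 0 *: mx2 0 b 1 0)).
      by rewrite rpredZ ?rpredB ?rpredZ.
    apply: mx2P; rewrite !mxE /= ?mulr0 ?mulr1 ?subr0 ?subrr ?mulr0 //.
    by rewrite [X 1 0 * b]mulrC mulVf.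
  move/negP: E_proper; apply; rewrite eqEsubv subvf /=; apply/subvP => Z _.
  rewrite (_ : Z = mx2 (Z 0 0) 0 0 (Z 1 1) + Z 1 0 *: mx2 0 b 1 0
      + (Z 0 1 - Z 1 0 * b) *: mx2 0 1 0 0); first by rewrite !rpredD ?rpredZ.
  by apply: mx2P; rewrite !mxE /=; ring.
have b1 : Normc.normc b = 1.
  apply/le_anti/andP; split; rewrite leNgt; apply/negP => b1.
    move: mu12; rewrite leNgt => /negP; apply.
    apply: (mu_lt1 b1) => X /E01 EX /det12 X10.
    (* Every admissible [X] for e12 has [b] as its 12-entry. *)
    by rewrite -[b]mulr1 -X10 -EX normc_le_opnorm.
  move: mu21; rewrite leNgt => /negP; apply.
  have b0 := normc_ge0 b.
  (* Admissibility for e21 gives [b * X 1 0 = 1], so the norm of [X] is at least the inverse of the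
     modulus of [b]. The constant lies between 1 and that inverse, and also covers [b = 0]. *)
  apply: (@mu_lt1 _ _ _ (2 / (1 + Normc.normc b))).
    by rewrite ltr_pdivlMr; lra.
  move=> X /E01 EX /det21; rewrite EX => /(congr1 (@Normc.normc R)).
  rewrite Normc.normcM Normc.normc1 => bX.
  apply: le_trans (normc_le_opnorm X 1 0).
  have := normc_ge0 (X 1 0); rewrite ler_pdivrMr; nra.
have bJ : b * b^*%C = 1 by rewrite -sqr_normcE b1 expr1n.
(* As [b] is unimodular, x12 = b x21 reads x21 = conj(b) x12, which is the shape required by
   [Etheta]. *)
have [theta thetaE] : exists theta, cis theta = b^*%C.
  apply: cis_surj; apply: complexI.
  by rewrite -normC_normc normcJ normC_normc b1.
exists theta; apply/seteqP; split=> [X /= EX|_ [z1 [z2 [w ->]]] /=].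
  exists (X 0 0), (X 1 1), (X 0 1).
  apply: mx2P; rewrite !mxE //= thetaE (E01 _ EX).
  by rewrite mulrA [_ * b]mulrC bJ mul1r.
rewrite (_ : mx2 _ _ _ _ = mx2 z1 0 0 z2 + (b^*%C * w) *: mx2 0 b 1 0).
  by rewrite rpredD ?rpredZ.
apply: mx2P; rewrite !mxE /= ?thetaE ?mulr0 ?mulr1 ?addr0 ?add0r //.
by rewrite mulrAC [_ * b]mulrC bJ mul1r.
Qed.
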